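(* For each $n\ge1$ let $X^{(n)}$ be an irreducible discrete-time Markov chain on a finite state space $\mathcal X^{(n)}$, and let $(x_0^{(n)},G^{(n)})$ be a reference pair in $\mathcal X^{(n)}$. Define the mean exit time $T_n^E:=\mathbb E\bigl(\tau^{(n),x_0^{(n)}}_{G^{(n)}}\bigr)$ and, for $\zeta\in(0,1)$, $Q_n(\zeta):=\inf\bigl\{k\ge1:\ \mathbb P\bigl(\tau^{(n),x_0^{(n)}}_{G^{(n)}}\le k\bigr)\ge 1-\zeta\bigr\}$. (I) If Hypothesis $Hp.G(T_n^E)$ holds, then: (i) $\tau^{(n),x_0^{(n)}}_{G^{(n)}}/T_n^E$ converges in law to an exponential random variable of rate $1$, i.e. for every $t>0$, $$\lim_{n\to\infty}\mathbb P\bigl(\tau^{(n),x_0^{(n)}}_{G^{(n)}}>t\,T_n^E\bigr)=e^{-t};$$ (ii) for every sequence $r_0^{(n)}\in(0,1)$ with $r_0^{(n)}\to0$ and every $t>0$, $$\lim_{n\to\infty}\ \sup_{x\in B(x_0^{(n)},r_0^{(n)})}\Bigl|\mathbb P\bigl(\tau^{(n),x}_{G^{(n)}}>t\,T_n^E\bigr)-e^{-t}\Bigr|=0.$$ (II) If, for a given $\zeta\in(0,1)$, Hypothesis $Hp.G(Q_n(\zeta))$ holds, then: (i) $\tau^{(n),x_0^{(n)}}_{G^{(n)}}/Q_n(\zeta)$ converges in law to an exponential random variable of rate $-\ln\zeta$, i.e. for every $t>0$, $$\lim_{n\to\infty}\mathbb P\bigl(\tau^{(n),x_0^{(n)}}_{G^{(n)}}>t\,Q_n(\zeta)\bigr)=\zeta^{t};$$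 (ii) $\displaystyle\lim_{n\to\infty}\frac{Q_n(\zeta)}{T_n^E}=-\ln\zeta.$
   Context: $X^{(n),x}=(X^{(n),x}_t)_{t\in\mathbb N}$ is the $n$-th chain started at $x$; $\tau^{(n),x}_F=\inf\{t\ge0:X^{(n),x}_t\in F\}$ for $F\subset\mathcal X^{(n)}$. A reference pair consists of $x_0^{(n)}\in\mathcal X^{(n)}$ and a nonempty set $G^{(n)}\subset\mathcal X^{(n)}$; $\{x_0^{(n)},G^{(n)}\}$ denotes $\{x_0^{(n)}\}\cup G^{(n)}$. No reversibility is assumed. Notation: for positive sequences, $B_n\prec A_n$ means $B_n/A_n\to0$. Hypothesis $Hp.G(T_n)$: $(T_n)$ is a positive sequence with $T_n\to\infty$, and there exist positive sequences $r_n\to0$ and $R_n\prec T_n$ such that $\sup_{x\in\mathcal X^{(n)}}\mathbb P\bigl(\tau^{(n),x}_{\{x_0^{(n)},G^{(n)}\}}>R_n\bigr)\le r_n$ for all $n$. Basin of attraction: $B(x_0^{(n)},r_0^{(n)}):=\bigl\{x\in\mathcal X^{(n)}:\ \mathbb P\bigl(\tau^{(n),x}_{\{x_0^{(n)},G^{(n)}\}}=\tau^{(n),x}_{\{x_0^{(n)}\}}\bigr)>1-r_0^{(n)}\bigr\}$. *)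

(* Defs.v *)
From HB Require Import structures.
From mathcomp Require Import all_boot all_order all_algebra.
From mathcomp Require Import all_classical all_reals all_analysis.

Set Implicit Arguments.
Unset Strict Implicit.
Unset Printing Implicit Defensive.

Import Order.TTheory GRing.Theory Num.Theory.
Import numFieldNormedType.Exports.

Local Open Scope classical_set_scope.
Local Open Scope ring_scope.

Definition stochastic (R : realType) (S : finType) (p : S -> S -> R) : Prop :=
  (forall x y, 0 <= p x y) /\ (forall x, \sum_(y : S) p x y = 1).

Fixpoint step_prob (R : realType) (S : finType) (p : S -> S -> R)
    (t : nat) (x y : S) : R :=
  if t is t'.+1 then \sum_(z : S) p x z * step_prob p t' z y else (x == y)%:R.

Definition irreducible (R : realType) (S : finType) (p : S -> S -> R) : Prop :=
  forall x y, exists t, 0 < step_prob p t x y.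

(* The last clause is P(X_{t+1} = s_{t+1} | X_0 = s_0, ..., X_t = s_t)
   = p(s_t, s_{t+1}), multiplied out so that no conditioning on a null event
   occurs. *)
Definition markov_chain (R : realType) (S : finType) (p : S -> S -> R) (x : S)
    (d : measure_display) (Omega : measurableType d) (P : probability Omega R)
    (X : nat -> Omega -> S) : Prop :=
  [/\ forall t s, measurable [set w | X t w = s],
      P [set w | X 0%N w = x] = 1%E
    & forall (t : nat) (s : nat -> S),
        P [set w | forall i, (i <= t.+1)%N -> X i w = s i] =
        (P [set w | forall i, (i <= t)%N -> X i w = s i] *
         (p (s t) (s t.+1))%:E)%E].

(* Valued in \bar R: the hitting time is +oo on paths that avoid F. *)
Definition hitting_time (R : realType) (S : finType) (Omega : Type)
    (X : nat -> Omega -> S) (F : set S) (w : Omega) : \bar R :=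
  ereal_inf [set (t%:R)%:E | t in [set t : nat | F (X t w)]].

(* For an irreducible chain and G nonempty, the expectation is finite, so that
   [fine] loses nothing. *)
Definition mean_exit_time (R : realType) (S : finType)
    (d : measure_display) (Omega : measurableType d) (P : probability Omega R)
    (X : nat -> Omega -> S) (G : set S) : R :=
  fine (\int[P]_w hitting_time R X G w)%E.

(* For an irreducible chain, G nonempty and 0 < zeta, the set is nonempty, so
   that the default value of [inf] is never used. *)
Definition exit_quantile (R : realType) (S : finType)
    (d : measure_display) (Omega : measurableType d) (P : probability Omega R)
    (X : nat -> Omega -> S) (G : set S) (zeta : R) : R :=
  inf [set k%:R | k in [set k : nat | (1 <= k)%N /\
    ((1 - zeta)%:E <= P [set w | hitting_time R X G w <= (k%:R)%:E])%E]].

Definition seq_prec (R : realType) (B A : nat -> R) : Prop :=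
  (B n / A n) @[n --> \oo] --> (0 : R).

Definition HpG (R : realType) (S : nat -> finType)
    (d : forall n, S n -> measure_display)
    (Omega : forall n (x : S n), measurableType (d n x))
    (P : forall n (x : S n), probability (Omega n x) R)
    (X : forall n (x : S n), nat -> Omega n x -> S n)
    (x0 : forall n, S n) (G : forall n, set (S n))
    (T : nat -> R) : Prop :=
  [/\ forall n, 0 < T n,
      T n @[n --> \oo] --> +oo
    & exists r Rn : nat -> R,
      [/\ (forall n, 0 < r n), r n @[n --> \oo] --> (0 : R),
          (forall n, 0 < Rn n), seq_prec Rn T
        & forall n,
          (ereal_sup
             [set P n x [set w |
                ((Rn n)%:E < hitting_time R (X n x) (x0 n |` G n) w)%E]
             | x in [set: S n]] <= (r n)%:E)%E]].

Definition basin (R : realType) (S : nat -> finType)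
    (d : forall n, S n -> measure_display)
    (Omega : forall n (x : S n), measurableType (d n x))
    (P : forall n (x : S n), probability (Omega n x) R)
    (X : forall n (x : S n), nat -> Omega n x -> S n)
    (x0 : forall n, S n) (G : forall n, set (S n))
    (n : nat) (r0 : R) : set (S n) :=
  [set x : S n | ((1 - r0)%:E <
     P n x [set w | hitting_time R (X n x) (x0 n |` G n) w =
                    hitting_time R (X n x) [set x0 n] w])%E].

(* Main.v *)
Require Import Defs.
From HB Require Import structures.
From mathcomp Require Import all_boot all_order all_algebra.
From mathcomp Require Import all_classical all_reals all_analysis.
From mathcomp Require Import measurable_realfun ring lra.

Set Implicit Arguments.
Unset Strict Implicit.
Unset Printing Implicit Defensive.

Import Order.TTheory GRing.Theory Num.Theory.
Import numFieldNormedType.Exports.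

Local Open Scope classical_set_scope.
Local Open Scope ring_scope.

(** Write f_n(k) for the probability that the n-th chain, started at its
    reference point, has not met G by time k, m_n for the integer part of R_n
    and r_n for the bound in the recurrence hypothesis.  Everything rests on
    the fact that the chain forgets its past each time it sits at the reference
    point, and that from anywhere it reaches the reference point or G within
    m_n steps, up to probability r_n.  Cutting a trajectory at time s and
    waiting for this return gives an approximate semigroup property in both
    directions:

      f(s + m + t) <= f(s) (r + f(t)),
      (f(s + m) - r f(s)) f(t) <= f(s + t).

    These are [survival_restart_ub] and [survival_restart_lb], collected in
    [renewal_bounds]; apart from them the argument is about sequences of
    functions on nat.

    Measure time in units of the quantile q_n, and write the level zeta as
    exp(-lambda).  Since m_n is negligible against q_n, iterating the upper
    bound shows that no mass escapes on a scale shorter than q_n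
    ([survival_small]): a fixed loss there, repeated boundedly many times,
    would bring f below zeta before time q_n.  Hence shifting an argument of f
    by a negligible time does not matter ([survival_near_continuous]), the
    semigroup property becomes multiplicativity in the limit
    ([survival_product]), and, f(q_n) being close to zeta, comparing f(A)^j
    with integer powers of zeta identifies the limit as exp(-lambda h) on
    every scale A ~ h q_n ([survival_scale]).

    The mean is the sum of f.  Shifting the summation index by A ~ h q_n
    multiplies the sum by a factor squeezed around exp(-lambda h), by the same
    two bounds, so that q_n / T_n lies asymptotically between
    (1 - exp(-lambda h)) / h and (1 - exp(-lambda h)) / (h exp(-lambda h));
    letting h tend to 0 gives the limit lambda ([quantile_over_mean]).

    When the recurrence time is compared with the mean exit time, the upper
    bound on the sum of f shows that the mean is at most a constant times the
    quantile of level exp(-1).  So that quantile satisfies the same hypothesis,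
    its ratio to the mean tends to 1, and the law of the exit time on the scale
    of the mean follows.  A point of the basin reaches the reference point
    before G within m_n steps, up to probability r_0 + r_n, and from then on it
    behaves like the reference point ([basin_survival_bounds]).

    The passage from the abstract processes to these quantities is
    [path_law]: the probability of an event about the first t + 1 positions
    is a finite sum computed from the transition kernel. *)

(** * Probabilities of finite trajectories *)

Section Kernel.
Variables (R : realType) (S : finType) (p : S -> S -> R).

(** This is P((X_0, ..., X_t) in A) for the chain started at [x].  Recursion on
    the first step turns uses of the Markov property into inductions on [t]. *)
Fixpoint path_prob (t : nat) (x : S) (A : seq S -> bool) : R :=
  if t is t'.+1 then \sum_y p x y * path_prob t' y (fun s => A (x :: s))
  else (A [:: x])%:R.

(** The tail of the hitting time of [G]: time 0 counts, so that it vanishes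
    when the chain starts in [G]. *)
Definition survival (G : set S) (t : nat) (x : S) : R :=
  path_prob t x (all (fun y => y \notin G)).

Fixpoint reaches_before (a : S) (G : set S) (s : seq S) : bool :=
  if s is x :: s' then (x == a) || (x \notin G) && reaches_before a G s'
  else false.

Definition reach (a : S) (G : set S) (t : nat) (x : S) : R :=
  path_prob t x (reaches_before a G).

Hypothesis p_stoch : stochastic p.

Let p_ge0 x y : 0 <= p x y. Proof. exact: p_stoch.1. Qed.
Let p_sum1 x : \sum_y p x y = 1. Proof. exact: p_stoch.2. Qed.

Lemma path_prob_ge0 t x A : 0 <= path_prob t x A.
Proof.
elim: t x A => [|t IH] x A /=; first exact: ler0n.
by apply: sumr_ge0 => y _; exact: mulr_ge0.
Qed.

Lemma average_cst x c : \sum_y p x y * c = c.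
Proof. by rewrite -mulr_suml p_sum1 mul1r. Qed.

Lemma path_prob_cst t x (b : bool) : path_prob t x (fun=> b) = b%:R.
Proof.
elim: t x => [|t IH] x //=; under eq_bigr do rewrite IH.
exact: average_cst.
Qed.

Lemma survival0 G x : survival G 0 x = (x \notin G)%:R.
Proof. by rewrite /survival /= andbT. Qed.

Lemma survivalS G t x :
  survival G t.+1 x = (x \notin G)%:R * \sum_y p x y * survival G t y.
Proof.
rewrite /survival /=; case: (x \notin G) => /=; first by rewrite mul1r.
rewrite mul0r; apply: big1 => y _; rewrite (path_prob_cst _ _ false).
by rewrite mulr0.
Qed.

Lemma survival_in G t x : x \in G -> survival G t x = 0.
Proof.
by case: t => [|t] xG; rewrite ?survival0 ?survivalS xG //= mul0r.
Qed.

Lemma survivalS_out G t x : x \notin G ->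
  survival G t.+1 x = \sum_y p x y * survival G t y.
Proof. by move=> xG; rewrite survivalS xG mul1r. Qed.

Lemma reach0 a G x : reach a G 0 x = (x == a)%:R.
Proof. by rewrite /reach /= andbF orbF. Qed.

Lemma reach_start a G t : reach a G t a = 1.
Proof.
case: t => [|t]; first by rewrite reach0 eqxx.
rewrite /reach /= eqxx /=; under eq_bigr do rewrite path_prob_cst.
exact: average_cst.
Qed.

Lemma reachS_out a G t x : x != a -> x \notin G ->
  reach a G t.+1 x = \sum_y p x y * reach a G t y.
Proof. by rewrite /reach /= => /negPf -> ->. Qed.

Lemma reach_in a G t x : x != a -> x \in G -> reach a G t x = 0.
Proof.
move=> xa xG; case: t => [|t]; first by rewrite reach0 (negPf xa).
rewrite /reach /= (negPf xa) xG /=; apply: big1 => y _.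
by rewrite (path_prob_cst _ _ false) mulr0.
Qed.

Lemma average_le x (u v : S -> R) : (forall y, u y <= v y) ->
  \sum_y p x y * u y <= \sum_y p x y * v y.
Proof. by move=> uv; apply: ler_sum => y _; exact: ler_wpM2l. Qed.

Lemma survival_ge0 G t x : 0 <= survival G t x.
Proof. exact: path_prob_ge0. Qed.

Lemma survival_le1 G t x : survival G t x <= 1.
Proof.
elim: t x => [|t IH] x; first by rewrite survival0 lern1 leq_b1.
have [xG|xG] := boolP (x \in G); first by rewrite survival_in.
by rewrite survivalS_out // -[leRHS](average_cst x); exact: average_le.
Qed.

Lemma survivalS_le G t x : survival G t.+1 x <= survival G t x.
Proof.
elim: t x => [|t IH] x; have [xG|xG] := boolP (x \in G).
- by rewrite !survival_in.
- by rewrite survival0 xG survival_le1.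
- by rewrite !survival_in.
by rewrite !(survivalS_out _ xG); exact: average_le.
Qed.

Lemma survival_le G s t x : (s <= t)%N -> survival G t x <= survival G s x.
Proof.
by move=> /subnK <-; elim: (t - s)%N => // k /(le_trans (survivalS_le _ _ _)).
Qed.

Section ReferencePair.
Variables (a : S) (G : set S).
Let F := a |` G.
Let f t := survival G t a.

Let notinF x : (x \notin F) = (x != a) && (x \notin G).
Proof.
rewrite -negb_or; congr (~~ _); apply/idP/idP.
  by move=> /set_mem [->|xG]; rewrite ?eqxx // (mem_set xG) orbT.
by move=> /orP[/eqP ->|/set_mem xG]; apply/mem_set; [left|right].
Qed.

(** Within [m] steps the chain avoids both [a] and [G], or is killed in [G], or
    visits [a], after which at least [t] of the [m + t] steps are left. *)
Lemma survival_pair_ub m t x :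
  survival G (m + t) x <= survival F m x + f t.
Proof.
elim: m x => [|m IH] x; have [xG|xG] := boolP (x \in G);
  try (by rewrite (survival_in _ xG) addr_ge0 ?survival_ge0);
  have [->|xa] := eqVneq x a.
- by rewrite add0n lerDr survival_ge0.
- by rewrite add0n survival0 notinF xa xG ler_wpDr ?survival_le1 ?survival_ge0.
- by rewrite (le_trans (survival_le _ _ (leq_addl _ t))) // lerDr survival_ge0.
rewrite addSn !survivalS_out // ?notinF ?xa //.
rewrite -[f t](average_cst x) -big_split /=.
by under [leRHS]eq_bigr do rewrite -mulrDr; exact: average_le.
Qed.

(** A trajectory that avoids [G] for [m] steps but not [a |` G] has visited [a];
    restarting there, it survives [t] more steps with probability [f t]. *)
Lemma survival_pair_lb m t x :
  (survival G m x - survival F m x) * f t <= survival G t x.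
Proof.
elim: m x => [|m IH] x; have [xG|xG] := boolP (x \in G).
- by rewrite !survival_in ?subrr ?mul0r // -[x \in _]negbK notinF xG andbF.
- have [->|xa] := eqVneq x a; last first.
    by rewrite !survival0 notinF xa xG subrr mul0r survival_ge0.
  by rewrite ler_piMl ?survival_ge0 // lerBlDr ler_wpDr ?survival_ge0
    ?survival_le1.
- by rewrite !survival_in ?subrr ?mul0r // -[x \in _]negbK notinF xG andbF.
have [->|xa] := eqVneq x a.
  by rewrite ler_piMl ?survival_ge0 // lerBlDr ler_wpDr ?survival_ge0
    ?survival_le1.
apply: le_trans (survivalS_le _ _ _).
rewrite !survivalS_out // ?notinF ?xa // -sumrB mulr_suml.
under eq_bigr do rewrite -mulrBr -mulrA.
exact: average_le.
Qed.

(** A trajectory that visits [a] before [G] has survived until that visit, and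
    [t] further steps of survival, of probability [f t], are more than enough. *)
Lemma survival_reach_lb m t x : reach a G m x * f t <= survival G t x.
Proof.
elim: m x => [|m IH] x; have [->|xa] := eqVneq x a.
- by rewrite reach_start mul1r.
- by rewrite reach0 (negPf xa) mul0r survival_ge0.
- by rewrite reach_start mul1r.
have [xG|xG] := boolP (x \in G); first by rewrite reach_in // mul0r survival_ge0.
apply: le_trans (survivalS_le _ _ _).
rewrite survivalS_out // reachS_out // mulr_suml.
by under eq_bigr do rewrite -mulrA; exact: average_le.
Qed.

Variables (m : nat) (r : R).
Hypothesis Fr : forall x, survival F m x <= r.

(** The Markov property at time [s], with the worst case over the position
    X_s replaced by the reference point. *)
Lemma survival_restart_ub s t x :
  survival G (s + (m + t)) x <= survival G s x * (r + f t).
Proof.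
elim: s x => [|s IH] x; have [xG|xG] := boolP (x \in G);
  try (by rewrite !(survival_in _ xG) mul0r).
  rewrite add0n survival0 xG mul1r.
  by apply: le_trans (survival_pair_ub _ _ _) _; rewrite lerD2r.
rewrite addSn !survivalS_out // mulr_suml.
by under [leRHS]eq_bigr do rewrite -mulrA; exact: average_le.
Qed.

Lemma survival_restart_lb s t x :
  (survival G (s + m) x - r * survival G s x) * f t <= survival G (s + t) x.
Proof.
elim: s x => [|s IH] x; have [xG|xG] := boolP (x \in G);
  try (by rewrite !(survival_in _ xG) mulr0 subrr mul0r).
  rewrite !add0n survival0 xG mulr1.
  apply: le_trans (survival_pair_lb m _ _).
  by rewrite ler_wpM2r ?survival_ge0 // lerB.
rewrite !addSn !survivalS_out // mulr_sumr -sumrB mulr_suml.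
under eq_bigr do rewrite mulrCA -mulrBr -mulrA.
exact: average_le.
Qed.

End ReferencePair.
End Kernel.

(** * Approximate semigroups on the integers *)

Section RenewalBounds.
Variables (R : realType).

(** [f] is a tail function, [m] a time within which the chain has returned to
    its reference point or been absorbed, and [r] the probability that this
    fails. *)
Record renewal_bounds (f : nat -> R) (m : nat) (r : R) : Prop :=
  RenewalBounds {
    rb_r : 0 <= r;
    rb_ge0 : forall t, 0 <= f t;
    rb_le1 : forall t, f t <= 1;
    rb_dec : forall s t, (s <= t)%N -> f t <= f s;
    rb_ub : forall s t, f (s + (m + t))%N <= f s * (r + f t);
    rb_lb : forall s t, (f (s + m)%N - r * f s) * f t <= f (s + t)%N }.

Variables (f : nat -> R) (m : nat) (r : R).
Hypothesis rb : renewal_bounds f m r.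
Let S N := \sum_(i < N) f i.

Lemma renewal_geometric j t : f (j * (m + t))%N <= (r + f t) ^+ j.
Proof.
elim: j => [|j IH]; first by rewrite expr0; exact: rb_le1 rb _.
rewrite mulSn addnC exprSr; apply: (le_trans (rb_ub rb _ _)).
by rewrite ler_wpM2r // addr_ge0 ?(rb_r rb) ?(rb_ge0 rb).
Qed.

(** Step back by [m] from [s]: the mass lost after [s] is either mass that
    failed to return to the reference point in between, or mass that is
    absorbed quickly from there. *)
Lemma renewal_near_continuous s t : (m <= s)%N ->
  f s - f (s + t)%N <= r + (1 - f (m + t)%N).
Proof.
move=> ms; have := rb_lb rb (s - m) (m + t).
rewrite addnA subnK //.
have := rb_r rb; have := rb_ge0 rb (m + t); have := rb_le1 rb (m + t).
have := rb_ge0 rb s; have := rb_le1 rb s.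
have := rb_ge0 rb (s - m); have := rb_le1 rb (s - m).
set a := f s; set b := f (m + t)%N; set c := f (s - m)%N; set d := f (s + t)%N.
move=> c1 c0 a1 a0 b1 b0 r0 H.
have cb : c * b <= 1 by rewrite mulr_ile1.
have : r * (c * b) <= r by rewrite ler_piMr.
nra.
Qed.

Lemma renewal_product s t : (m <= t)%N ->
  `|f (s + t)%N - f s * f t|
    <= r + (f s - f (s + m)%N) + (f (t - m)%N - f t).
Proof.
move=> mt; have := rb_ub rb s (t - m); rewrite subnKC //.
have := rb_lb rb s t.
have := rb_dec rb (leq_subr m t); have := rb_dec rb (leq_addr m s).
have := rb_r rb; have := rb_ge0 rb s; have := rb_le1 rb s.
have := rb_ge0 rb t; have := rb_le1 rb t.
move: (f s) (f t) (f (s + m)%N) (f (t - m)%N) (f (s + t)%N).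
move=> a b a' b' c b1 b0 a1 a0 r0 aa bb L U.
have ab : a * b <= 1 by rewrite mulr_ile1.
have h1 : r * (a * b) <= r by rewrite ler_piMr.
have h2 : r * a <= r by rewrite ler_piMr.
have h3 : (a - a') * b <= a - a' by rewrite ler_piMr // subr_ge0.
have h4 : a * (b' - b) <= b' - b by rewrite ler_piMl // subr_ge0.
rewrite ler_norml; apply/andP; split; lra.
Qed.

Lemma sum_shift A N : S (A + N) = S A + \sum_(i < N) f (A + i)%N.
Proof. by rewrite /S big_split_ord. Qed.

Lemma sum_le_shift A N : S N <= S (A + N).
Proof.
rewrite /S addnC big_split_ord /= lerDl.
by apply: sumr_ge0 => i _; exact: rb_ge0 rb _.
Qed.

(** Shifting the index by [m + t] multiplies the terms of the sum by at most
    [r + f t], while the first [m + t] terms are at most 1.  Working with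
    partial sums makes summability a consequence. *)
Lemma renewal_sum_ub t N : S N * (1 - (r + f t)) <= (m + t)%:R.
Proof.
have le1 : S N <= S (m + t + N) := sum_le_shift _ _.
have : S (m + t) <= (m + t)%:R.
  rewrite -[leRHS]mulr1 mulr_natl -[X in _ *+ X]card_ord -sumr_const.
  by apply: ler_sum => i _; exact: rb_le1 rb _.
have : \sum_(i < N) f (m + t + i)%N <= S N * (r + f t).
  rewrite /S mulr_suml; apply: ler_sum => i _.
  by rewrite addnC; exact: rb_ub rb _ _.
by move: le1; rewrite sum_shift; lra.
Qed.

(** The reverse shift: the first [A] terms are at least [f A], and the rest is
    at least a multiple of the whole sum. *)
Lemma renewal_sum_lb A T : 0 < f (A + m)%N - r ->
  (forall N, S N <= T) -> (forall B, (forall N, S N <= B) -> T <= B) ->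
  A%:R * f A <= T * (1 - (f (A + m)%N - r)).
Proof.
set l := f (A + m)%N - r => l0 ubT lubT.
suff : T <= (T - A%:R * f A) / l by rewrite ler_pdivlMr //; lra.
apply: lubT => N; rewrite ler_pdivlMr //.
have h1 : A%:R * f A <= S A.
  rewrite mulr_natl -[X in _ *+ X]card_ord -sumr_const.
  by apply: ler_sum => i _; apply: rb_dec rb _ _ _; exact: ltnW.
have h2 : S N * l <= \sum_(i < N) f (A + i)%N.
  rewrite /S mulr_suml; apply: ler_sum => i _.
  apply: le_trans (rb_lb rb A i); rewrite mulrC.
  apply: ler_wpM2r; first exact: rb_ge0 rb _.
  by rewrite lerB // ler_piMr ?(rb_r rb) ?(rb_le1 rb).
have := ubT (A + N)%N; rewrite sum_shift; lra.
Qed.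

End RenewalBounds.

(** * Limits of real sequences *)

Lemma cvg_near_ext (R : realType) (u v : nat -> R) (l : R) :
  (\forall n \near \oo, u n = v n) -> u n @[n --> \oo] --> l ->
  v n @[n --> \oo] --> l.
Proof.
move=> uv; apply: cvg_trans; apply: near_eq_cvg.
by apply: filterS uv => n ->.
Qed.

Lemma cvg_lt_near (R : realType) (u : nat -> R) (l z : R) :
  u n @[n --> \oo] --> l -> l < z -> \forall n \near \oo, u n < z.
Proof. by move=> ul lz; exact: (cvgr_lt _ ul). Qed.

Lemma cvg_gt_near (R : realType) (u : nat -> R) (l z : R) :
  u n @[n --> \oo] --> l -> z < l -> \forall n \near \oo, z < u n.
Proof. by move=> ul lz; exact: (cvgr_gt _ ul). Qed.

Lemma cvg_dist_near (R : realType) (u : nat -> R) (l : R) :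
  u n @[n --> \oo] --> l <->
  (forall e : R, 0 < e -> \forall n \near \oo, `|u n - l| <= e).
Proof. by split=> [/cvgrPdistC_le|?]; last exact/cvgrPdistC_le. Qed.

Lemma cvg_continuous (R : realType) (g : R -> R) (u : nat -> R) (l : R) :
  continuous g -> u n @[n --> \oo] --> l -> g (u n) @[n --> \oo] --> g l.
Proof. by move=> gc; apply: continuous_cvg; exact: gc. Qed.

Lemma cvg_expR_scale (R : realType) (c : R) (u : nat -> R) (l : R) :
  u n @[n --> \oo] --> l -> expR (c * u n) @[n --> \oo] --> expR (c * l).
Proof.
move=> ul; apply: cvg_continuous; first exact: continuous_expR.
by apply: cvgM ul; exact: cvg_cst.
Qed.

(** * Survival on the scale of the quantile *)

Section Asymptotics.
Variables (R : realType) (f : nat -> nat -> R) (m : nat -> nat) (r : nat -> R).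
Variables (q : nat -> nat) (lam : R).

(** Times asymptotic to [h] quantiles. *)
Let scale (A : nat -> nat) (h : R) := (A n)%:R / (q n)%:R @[n --> \oo] --> h.

Hypothesis rb : forall n, renewal_bounds (f n) (m n) (r n).
Hypothesis r0 : r n @[n --> \oo] --> 0.
Hypothesis m0 : scale m 0.
Hypothesis q_infty : (q n)%:R @[n --> \oo] --> (+oo : set_system R).
Hypothesis lam_gt0 : 0 < lam.
Hypothesis q_quantile :
  \forall n \near \oo, f n (q n) <= expR (- lam) < f n (q n).-1.

Lemma scaleD A B a b : scale A a -> scale B b ->
  scale (fun n => A n + B n)%N (a + b).
Proof.
move=> Aa Bb; apply: cvg_near_ext (cvgD Aa Bb).
by apply: nearW => n; rewrite natrD mulrDl.
Qed.

Lemma scaleMn j A a : scale A a -> scale (fun n => j * A n)%N (j%:R * a).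
Proof.
move=> Aa.
have : j%:R * ((A n)%:R / (q n)%:R) @[n --> \oo] --> j%:R * a.
  by apply: cvgM Aa; exact: cvg_cst.
apply: cvg_near_ext.
by apply: nearW => n; rewrite natrM -mulrA.
Qed.

Lemma q_gt0 : \forall n \near \oo, 0 < (q n)%:R :> R.
Proof. by move/cvgryPgt: q_infty; apply. Qed.

Lemma scale_lt A B a b : scale A a -> scale B b -> a < b ->
  \forall n \near \oo, (A n < B n)%N.
Proof.
move=> Aa Bb ab.
have [c1 c2] : a < (a + b) / 2 /\ (a + b) / 2 < b by split; lra.
have h1 := cvg_lt_near Aa c1; have h2 := cvg_gt_near Bb c2.
apply: filterS3 q_gt0 h1 h2 => n q0 x y; have := lt_trans x y.
by rewrite ltr_pM2r ?invr_gt0 // ltr_nat.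
Qed.

Lemma scale_q : scale q 1.
Proof.
apply: cvg_near_cst; apply: filterS q_gt0 => n q0.
by rewrite divff // gt_eqF.
Qed.

Lemma qV : (q n)%:R^-1 @[n --> \oo] --> (0 : R).
Proof. by apply/gtr0_cvgV0; [exact: q_gt0|exact: q_infty]. Qed.

Lemma scale_q_pred : scale (fun n => (q n).-1) 1.
Proof.
have : (q n)%:R / (q n)%:R - (q n)%:R^-1 @[n --> \oo] --> (1 - 0 : R).
  by apply: cvgB; [exact: scale_q|exact: qV].
rewrite subr0; apply: cvg_near_ext.
apply: filterS q_gt0 => n; rewrite ltr0n => q0.
by rewrite -subn1 natrB // mulrBl mul1r.
Qed.

Lemma scaleB A B a b : scale A a -> scale B b -> b < a ->
  scale (fun n => A n - B n)%N (a - b).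
Proof.
move=> Aa Bb ba; apply: cvg_near_ext (cvgB Aa Bb).
apply: filterS (scale_lt Bb Aa ba) => n /ltnW BA.
by rewrite natrB // mulrBl.
Qed.

Lemma scale_truncn (T : nat -> R) h : (forall n, 0 <= T n) ->
  T n / (q n)%:R @[n --> \oo] --> h -> scale (fun n => Num.truncn (T n)) h.
Proof.
move=> T0 Th; apply: (@squeeze_cvgr _ _ _ _
  (fun n => T n / (q n)%:R - (q n)%:R^-1) (fun n => T n / (q n)%:R)) => //; last first.
  by rewrite -[h]subr0; apply: cvgB => //; exact: qV.
apply: filterS q_gt0 => n q0; have /andP[h1 h2] := truncn_itv (T0 n).
rewrite -[X in _ - X]mul1r -mulrBl !ler_pM2r ?invr_gt0 // h1 andbT.
by rewrite lerBlDr natr1 ltW.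
Qed.

(** If [f n (A n)] stayed below 1 by a fixed amount, then after a bounded number
    [j] of blocks of length [m n + A n] the survival probability would be below
    the level of the quantile; but these blocks end before the quantile. *)
Lemma survival_small A : scale A 0 -> f n (A n) @[n --> \oo] --> (1 : R).
Proof.
move=> A0; apply/cvg_dist_near => e e0.
have [d [d0 d1 de]] : exists d : R, [/\ 0 < d, d <= 1 & d <= e].
  by exists (Num.min e 1); rewrite lt_min e0 ltr01 !ge_min !lexx orbT.
pose c : R := 1 - d / 2.
have [c0 c1] : 0 < c /\ c < 1.
  by rewrite /c; split; lra.
have [j cj] : exists j, c ^+ j < expR (- lam).
  have /cvg_expr cc : `|c| < 1 by rewrite gtr0_norm.
  have [j _ hj] := cvg_lt_near cc (expR_gt0 (- lam)).
  by exists j; apply: hj => /=.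
have h1 : \forall n \near \oo, (j * (m n + A n) < (q n).-1)%N.
  apply: scale_lt scale_q_pred ltr01.
  by have := scaleMn (j := j) (scaleD m0 A0); rewrite addr0 mulr0.
have h2 : \forall n \near \oo, r n < d / 2.
  by apply: (cvg_lt_near r0); lra.
apply: filterS3 h1 h2 q_quantile => n jq rn /andP[_ fq].
have f1 := rb_le1 (rb n) (A n).
rewrite distrC ger0_norm ?subr_ge0 // lerBlDr -lerBlDl leNgt; apply/negP => fA.
have fr : r n + f n (A n) <= c.
  by rewrite /c; lra.
have := rb_dec (rb n) (ltnW jq).
have := renewal_geometric (rb n) j (A n).
have : (r n + f n (A n)) ^+ j <= c ^+ j.
  apply: lerXn2r; rewrite ?nnegrE ?(ltW c0) //.
  by rewrite addr_ge0 ?(rb_r (rb n)) ?(rb_ge0 (rb n)).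
move=> x y z; have := lt_le_trans fq (le_trans z (le_trans y x)).
by rewrite ltNge (ltW cj).
Qed.

Lemma survival_near_continuous A D a : 0 < a -> scale A a -> scale D 0 ->
  f n (A n) - f n (A n + D n)%N @[n --> \oo] --> (0 : R).
Proof.
move=> a0 Aa D0; apply: (@squeeze_cvgr _ _ _ _
  (fun=> 0) (fun n => r n + (1 - f n (m n + D n)%N))).
- apply: filterS (scale_lt m0 Aa a0) => n /ltnW mA.
  by rewrite subr_ge0 (rb_dec (rb n)) ?leq_addr // renewal_near_continuous.
- exact: cvg_cst.
- have -> : 0 = 0 + (1 - 1) :> R by rewrite subrr addr0.
  apply: cvgD => //; apply: cvgB; first exact: cvg_cst.
  by apply: survival_small; have := scaleD m0 D0; rewrite addr0.
Qed.

(** The error terms of [renewal_product] are increments of [f] over time [m n],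
    which are negligible. *)
Lemma survival_product A B a b : 0 < a -> 0 < b -> scale A a -> scale B b ->
  f n (A n + B n)%N - f n (A n) * f n (B n) @[n --> \oo] --> (0 : R).
Proof.
move=> a0 b0 Aa Bb; apply/cvg_dist_near => e e0.
have h1 : r n + (f n (A n) - f n (A n + m n)%N) +
    (f n (B n - m n)%N - f n (B n - m n + m n)%N) @[n --> \oo] --> (0 : R).
  have -> : 0 = 0 + 0 + 0 :> R by rewrite !addr0.
  apply: cvgD; first apply: cvgD => //.
    exact: survival_near_continuous Aa m0.
  have Bm := scaleB Bb m0 b0; rewrite subr0 in Bm.
  exact: survival_near_continuous b0 Bm m0.
apply: filterS2 (cvg_lt_near h1 e0) (scale_lt m0 Bb b0) => n /ltW he /ltnW mB.
by move: he; rewrite subr0 subnK //; apply: le_trans; exact: renewal_product.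
Qed.

Lemma survival_pow A a j : 0 < a -> scale A a ->
  f n (j.+1 * A n)%N - f n (A n) ^+ j.+1 @[n --> \oo] --> (0 : R).
Proof.
move=> a0 Aa; elim: j => [|j IH].
  by under eq_fun do rewrite mul1n expr1 subrr; exact: cvg_cst.
have h := survival_product (mulr_gt0 (ltr0Sn R j) a0) a0 (scaleMn (j := j.+1) Aa) Aa.
apply/cvg_dist_near => e e0; have e20 : 0 < e / 2 by lra.
move/cvg_dist_near: h => /(_ _ e20) h; move/cvg_dist_near: IH => /(_ _ e20) IH.
apply: filterS2 h IH => n; rewrite !subr0 => h1 h2.
rewrite mulSn addnC (exprSr _ j.+1).
have -> : f n (j.+1 * A n + A n)%N - f n (A n) ^+ j.+1 * f n (A n) =
  (f n (j.+1 * A n + A n)%N - f n (j.+1 * A n)%N * f n (A n)) +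
  (f n (j.+1 * A n)%N - f n (A n) ^+ j.+1) * f n (A n) by ring.
have -> : e = e / 2 + e / 2 by lra.
apply: le_trans (ler_normD _ _) (lerD h1 _).
rewrite normrM (ger0_norm (rb_ge0 (rb n) _)); apply: le_trans h2.
by rewrite ler_piMr ?(rb_le1 (rb n)).
Qed.


(** The level is crossed between [q - 1] and [q], and one step is negligible. *)
Lemma survival_quantile : f n (q n) @[n --> \oo] --> expR (- lam).
Proof.
have h : f n (q n).-1 - f n ((q n).-1 + 1)%N @[n --> \oo] --> (0 : R).
  apply: survival_near_continuous ltr01 scale_q_pred _.
  by apply: cvg_near_ext qV; apply: nearW => n; rewrite mul1r.
apply/cvg_dist_near => e e0.
apply: filterS3 (cvg_lt_near h e0) q_quantile q_gt0 => n.
move=> hn /andP[f1 f2]; rewrite ltr0n => qn0.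
move: hn; rewrite addn1 prednK // => hn.
by rewrite ler_norml; apply/andP; split; lra.
Qed.

Lemma survival_quantile_pow k :
  f n (k * q n)%N @[n --> \oo] --> expR (- lam) ^+ k.
Proof.
case: k => [|k].
  rewrite expr0; apply: survival_small; apply: cvg_near_cst.
  by apply: nearW => n; rewrite mul0n mul0r.
have h1 := survival_pow k ltr01 scale_q.
have h2 : f n (q n) ^+ k.+1 @[n --> \oo] --> expR (- lam) ^+ k.+1.
  apply: (cvg_continuous (g := fun x => x ^+ k.+1)) survival_quantile.
  exact: exprn_continuous.
have : f n (k.+1 * q n)%N - f n (q n) ^+ k.+1 + f n (q n) ^+ k.+1 @[n --> \oo] -->
    0 + expR (- lam) ^+ k.+1 by exact: cvgD.
rewrite add0r; apply: cvg_near_ext.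
by apply: nearW => n; rewrite subrK.
Qed.

(** Comparing [j A] with integer multiples of the quantile locates [f(A)^j]
    between integer powers of [expR (- lam)], hence [f(A)] up to an error of
    order [1 / j] in the exponent. *)
Lemma survival_scale_bounds A h (j : nat) : 0 < h -> 3 <= j.+1%:R * h ->
  scale A h -> \forall n \near \oo,
    expR (- (lam * (h + 3 / j.+1%:R))) <= f n (A n) <=
    expR (- (lam * (h - 3 / j.+1%:R))).
Proof.
move=> h0 jh Ah; set z := expR (- lam).
have j0 : 0 < j.+1%:R :> R by rewrite ltr0Sn.
have z0 : 0 < z by exact: expR_gt0.
have z1 : z < 1 by rewrite /z -[ltRHS]expR0 ltr_expR oppr_lt0.
have zdec k : z ^+ k.+1 < z ^+ k by rewrite exprS gtr_pMl ?exprn_gt0.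
(* j h lies in [k + 2, k + 3[; one unit of slack on each side makes the
   comparison of times strict, and another one absorbs the error terms. *)
have jh2 : 0 <= j.+1%:R * h - 2 by lra.
have /andP[] := truncn_itv jh2; set k := Num.truncn _; rewrite -(natr1 k) => k1 k2.
have le_root (x s : R) : 0 <= x -> (x <= expR s) = (x ^+ j.+1 <= expR s ^+ j.+1).
  by move=> x0; rewrite ler_pXn2r // nnegrE // expR_ge0.
have ge_root (x s : R) : 0 <= x -> (expR s <= x) = (expR s ^+ j.+1 <= x ^+ j.+1).
  by move=> x0; rewrite ler_pXn2r // nnegrE // expR_ge0.
have jA := scaleMn (j := j.+1) Ah.
have qk i : scale (fun n => i * q n)%N i%:R.
  by have := scaleMn (j := i) scale_q; rewrite mulr1.
have lo : \forall n \near \oo, (j.+1 * A n < k.+3 * q n)%N.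
  by apply: scale_lt jA (qk _) _; rewrite -(addn3 k) natrD; lra.
have up : \forall n \near \oo, (k.+1 * q n < j.+1 * A n)%N.
  by apply: scale_lt (qk _) jA _; rewrite -(natr1 k); lra.
have /cvg_dist_near powA := survival_pow j h0 Ah.
have gap i : 0 < (z ^+ i - z ^+ i.+1) / 2 by have := zdec i; lra.
have /cvg_dist_near := survival_quantile_pow (k := k.+3) => /(_ _ (gap k.+3)) q3.
have /cvg_dist_near := survival_quantile_pow (k := k.+1) => /(_ _ (gap k)) q1.
have lower : \forall n \near \oo, z ^+ k.+4 <= f n (A n) ^+ j.+1.
  apply: filterS3 (powA _ (gap k.+3)) lo q3 => n; rewrite subr0 => h1 /ltnW h2 h3.
  have h4 := rb_dec (rb n) h2.
  by move: h1 h3; rewrite !ler_norml -/z => /andP[? ?] /andP[? ?]; lra.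
have upper : \forall n \near \oo, f n (A n) ^+ j.+1 <= z ^+ k.
  apply: filterS3 (powA _ (gap k)) up q1 => n; rewrite subr0 => h1 /ltnW h2 h3.
  have h4 := rb_dec (rb n) h2.
  by move: h1 h3; rewrite !ler_norml -/z => /andP[? ?] /andP[? ?]; lra.
apply: filterS2 lower upper => n lown upn; have f0 := rb_ge0 (rb n) (A n).
rewrite ge_root // le_root //; apply/andP; split.
  apply: le_trans lown; rewrite /z -!expRM_natl ler_expR.
  rewrite !mulrN lerN2 mulrCA [leLHS]mulrC ler_pM2l // mulrDr mulrCA divff ?gt_eqF //.
  by rewrite -(addn4 k) natrD; lra.
apply: le_trans upn _; rewrite /z -!expRM_natl ler_expR.
rewrite !mulrN lerN2 mulrCA [leRHS]mulrC ler_pM2l // mulrBr mulrCA divff ?gt_eqF //.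
by lra.
Qed.

Lemma survival_scale A h : 0 < h -> scale A h ->
  f n (A n) @[n --> \oo] --> expR (- (lam * h)).
Proof.
move=> h0 Ah; apply/cvg_dist_near => e e0.
have width : 3 / j.+1%:R @[j --> \oo] --> (0 : R).
  rewrite -[X in _ --> X](mulr0 3).
  by apply: cvgM; [exact: cvg_cst|exact: cvg_harmonic].
have upw : expR (- lam * (h - 3 / j.+1%:R)) @[j --> \oo] --> expR (- lam * (h - 0)).
  by apply: cvg_expR_scale; apply: cvgB; [exact: cvg_cst|exact: width].
have low : expR (- lam * (h + 3 / j.+1%:R)) @[j --> \oo] --> expR (- lam * (h + 0)).
  by apply: cvg_expR_scale; apply: cvgD; [exact: cvg_cst|exact: width].
have [j [jh]] : exists j, [/\ 3 / j.+1%:R < h,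
    `|expR (- lam * (h - 3 / j.+1%:R)) - expR (- lam * (h - 0))| <= e &
    `|expR (- lam * (h + 3 / j.+1%:R)) - expR (- lam * (h + 0))| <= e].
  have := cvg_lt_near width h0; have := (cvg_dist_near _ _).1 low _ e0.
  have := (cvg_dist_near _ _).1 upw _ e0 => a b c.
  apply: (@filter_ex _ \oo); move: a b c.
  by apply: filterS3 => j *; split.
rewrite subr0 addr0 !mulNr !ler_norml => /andP[? ?] /andP[? ?].
have {}jh : 3 <= j.+1%:R * h by rewrite mulrC -ler_pdivrMr ?ltr0Sn // ltW.
apply: filterS (survival_scale_bounds h0 jh Ah) => n /andP[lo up].
by rewrite ler_norml; apply/andP; split; lra.
Qed.


(** Both bounds on the sum applied with [A ~ h q], together with
    [1 + y <= expR y] at [y = lam h] and [y = - lam h].  The hypothesis on [T]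
    says that it is the sum of the series whenever the latter converges. *)
Lemma quantile_over_mean_bounds (T : nat -> R) (h e : R) : 0 < h -> 0 < e ->
  (forall n B, (forall N, \sum_(i < N) f n i <= B) ->
     (forall N, \sum_(i < N) f n i <= T n) /\ T n <= B) ->
  \forall n \near \oo,
    lam * expR (- (lam * h)) - e <= (q n)%:R / T n <=
    lam * expR (lam * h) + e.
Proof.
move=> h0 e0 hT; set z := expR (- (lam * h)).
have z0 : 0 < z by exact: expR_gt0.
have lh : 0 < lam * h by exact: mulr_gt0.
have z1 : z < 1 by rewrite /z -[ltRHS]expR0 ltr_expR oppr_lt0.
have zV : expR (lam * h) = z^-1 by rewrite /z expRN invrK.
pose A n := Num.truncn (h * (q n)%:R).
have Ah : scale A h.
  apply: scale_truncn => [n|]; first by rewrite mulr_ge0 ?ler0n // ltW.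
  apply: cvg_near_cst; apply: filterS q_gt0 => n q0.
  by rewrite mulfK // gt_eqF.
have fA : f n (A n) @[n --> \oo] --> z by exact: survival_scale.
have ul : r n + f n (A n - m n)%N @[n --> \oo] --> 0 + z.
  apply: cvgD => //; apply: survival_scale => //.
  by have := scaleB Ah m0 h0; rewrite subr0.
have ll : f n (A n + m n)%N - r n @[n --> \oo] --> z - 0.
  apply: cvgB => //; apply: survival_scale => //.
  by have := scaleD Ah m0; rewrite addr0.
rewrite add0r in ul; rewrite subr0 in ll.
have lo : (1 - (r n + f n (A n - m n)%N)) / ((A n)%:R / (q n)%:R) @[n --> \oo]
    --> (1 - z) / h.
  apply: cvgM; first by apply: cvgB => //; exact: cvg_cst.
  by apply: cvgV => //; rewrite gt_eqF.
have up : (1 - (f n (A n + m n)%N - r n)) / ((A n)%:R / (q n)%:R * f n (A n))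
    @[n --> \oo] --> (1 - z) / (h * z).
  apply: cvgM; first by apply: cvgB => //; exact: cvg_cst.
  by apply: cvgV; [rewrite mulf_neq0 // gt_eqF|exact: cvgM].
have zn0 : z != 0 by rewrite gt_eqF.
have hn0 : h != 0 by rewrite gt_eqF.
have lo' : lam * z - e < (1 - z) / h.
  have : (1 + lam * h) * z <= 1.
    by rewrite -[leRHS](mulVf zn0) ler_pM2r // -zV expR_ge1Dx.
  by have := mulr_gt0 e0 h0; rewrite ltr_pdivlMr //; lra.
have up' : (1 - z) / (h * z) < lam * expR (lam * h) + e.
  have hz : 0 < h * z by rewrite mulr_gt0.
  rewrite ltr_pdivrMr // zV.
  have -> : (lam / z + e) * (h * z) = lam * h + e * (h * z) by field.
  have := mulr_gt0 e0 hz; have := expR_ge1Dx (- (lam * h)); rewrite -/z; lra.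
have good : \forall n \near \oo, [/\ (m n < A n)%N, 0 < f n (A n) &
    r n + f n (A n - m n)%N < 1 /\ 0 < f n (A n + m n)%N - r n].
  have := cvg_gt_near ll z0; have := cvg_lt_near ul z1; have := cvg_gt_near fA z0.
  by move: (scale_lt m0 Ah h0) => a b c d; near=> n; split; [|..|split]; near: n.
have := cvg_gt_near lo lo'; have := cvg_lt_near up up'; move: q_gt0 => a b c.
near=> n.
have [mA fA0 [u1 l0]] : [/\ (m n < A n)%N, 0 < f n (A n) &
    r n + f n (A n - m n)%N < 1 /\ 0 < f n (A n + m n)%N - r n] by near: n.
have qn : 0 < (q n)%:R :> R by near: n.
have A0 : 0 < (A n)%:R :> R by rewrite ltr0n (leq_ltn_trans _ mA).
have ub N : \sum_(i < N) f n i <= (A n)%:R / (1 - (r n + f n (A n - m n)%N)).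
  rewrite ler_pdivlMr ?subr_gt0 //.
  by have := renewal_sum_ub (rb n) (A n - m n) N; rewrite subnKC // ltnW.
have [ST TB] := hT n _ ub.
have TA := renewal_sum_lb (rb n) l0 ST (fun B hB => (hT n B hB).2).
have AfA : 0 < (A n)%:R * f n (A n) by rewrite mulr_gt0.
have T0 : 0 < T n.
  have : 0 <= T n by have := ST 0%N; rewrite big_ord0.
  by rewrite le0r => /orP[/eqP T0|//]; move: TA; rewrite T0; lra.
apply/andP; split.
  have /ltW/le_trans -> // : lam * z - e <
    (1 - (r n + f n (A n - m n)%N)) / ((A n)%:R / (q n)%:R) by near: n.
  rewrite invf_div mulrCA ler_pM2l // -invf_div lef_pV2 // posrE //.
  by rewrite divr_gt0 // subr_gt0.
have /ltW : (1 - (f n (A n + m n)%N - r n)) / ((A n)%:R / (q n)%:R * f n (A n)) <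
  lam * expR (lam * h) + e by near: n.
apply: le_trans; rewrite ler_pdivrMr //.
have -> : (1 - (f n (A n + m n)%N - r n)) / ((A n)%:R / (q n)%:R * f n (A n)) * T n
  = (q n)%:R * ((T n * (1 - (f n (A n + m n)%N - r n))) / ((A n)%:R * f n (A n))).
  by field; rewrite !gt_eqF.
by rewrite ler_pMr // ler_pdivlMr // mul1r.
Unshelve. all: by end_near.
Qed.

Lemma quantile_over_mean (T : nat -> R) :
  (forall n B, (forall N, \sum_(i < N) f n i <= B) ->
     (forall N, \sum_(i < N) f n i <= T n) /\ T n <= B) ->
  (q n)%:R / T n @[n --> \oo] --> lam.
Proof.
move=> hT; apply/cvg_dist_near => e e0; have e20 : 0 < e / 2 by lra.
have lim (c : R) : lam * expR (c * harmonic j) @[j --> \oo] --> lam.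
  have : lam * expR (c * harmonic j) @[j --> \oo] --> lam * expR (c * 0).
    by apply: cvgM; [exact: cvg_cst|exact/cvg_expR_scale/cvg_harmonic].
  by rewrite mulr0 expR0 mulr1.
have [j [low up]] : exists j : nat,
    `|lam * expR (- lam * harmonic j) - lam| <= e / 2 /\
    `|lam * expR (lam * harmonic j) - lam| <= e / 2.
  apply: (@filter_ex _ \oo).
  move: ((cvg_dist_near _ _).1 (lim (- lam)) _ e20).
  move: ((cvg_dist_near _ _).1 (lim lam) _ e20).
  by apply: filterS2 => j.
have h0 : 0 < harmonic j :> R by rewrite /harmonic /= invr_gt0 ltr0Sn.
apply: filterS (quantile_over_mean_bounds h0 e20 hT) => n.
move: low up; rewrite mulNr !ler_norml => /andP[? ?] /andP[? ?] /andP[? ?].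
by apply/andP; split; lra.
Qed.
End Asymptotics.

(** * Hitting times as functions of the trajectory *)

Section HittingTime.
Variables (R : realType) (S : finType) (Omega : Type) (X : nat -> Omega -> S).
Implicit Types (F : set S) (w : Omega).

Lemma hitting_time_gt F w (t : R) : 0 <= t ->
  (t%:E < hitting_time R X F w)%E <->
  (forall i, (i <= Num.truncn t)%N -> X i w \notin F).
Proof.
move=> t0; split=> [tF i it|noF].
  apply/negP => /set_mem Fi; move: tF; rewrite ltNge => /negP; apply.
  apply: (le_trans (y := (i%:R)%:E)); first by apply: ereal_inf_lbound; exists i.
  by rewrite lee_fin -truncn_ge_nat.
apply: (lt_le_trans (y := ((Num.truncn t).+1%:R)%:E)).
  by rewrite lte_fin truncnS_gt.
apply: le_ereal_inf_tmp => _ [i /= Fi <-]; rewrite lee_fin ler_nat ltnNge.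
by apply/negP => /noF; rewrite mem_set.
Qed.

Lemma hitting_time_gt_nat F w k :
  ((k%:R : R)%:E < hitting_time R X F w)%E <->
  (forall i, (i <= k)%N -> X i w \notin F).
Proof. by rewrite hitting_time_gt ?ler0n // natrK. Qed.

(** Counting the integers below the hitting time; this makes it measurable and
    gives its expectation by monotone convergence. *)
Lemma hitting_time_series F w : hitting_time R X F w =
  (\sum_(k <oo)
     (\1_[set w | ((k%:R : R)%:E < hitting_time R X F w)%E] w : R)%:E)%E.
Proof.
have ge0 k : (0 <= (\1_[set w | ((k%:R : R)%:E < hitting_time R X F w)%E] w : R)%:E)%E.
  by rewrite lee_fin indicE ler0n.
have ind1 k : (forall i, (i <= k)%N -> X i w \notin F) ->
    (\1_[set w | ((k%:R : R)%:E < hitting_time R X F w)%E] w : R) = 1.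
  by move=> /hitting_time_gt_nat kF; rewrite indicE mem_set.
have [[k Fk]|noF] := pselect (exists k, X k w \in F); last first.
  have noF' k : X k w \notin F by apply/negP => Fk; apply: noF; exists k.
  transitivity (+oo%E : \bar R).
    rewrite /hitting_time -[RHS]ereal_inf0; congr ereal_inf.
    by apply/seteqP; split=> // y [k /= /mem_set Fk _]; have := noF' k; rewrite Fk.
  apply/esym/eqyP => A A0.
  apply: (le_trans (y := ((Num.truncn A).+1%:R)%:E)).
    by rewrite lee_fin ltW // truncnS_gt.
  apply: le_trans (nneseries_lim_ge (Num.truncn A).+1 _); last by move=> i _ _; exact: ge0.
  rewrite (eq_bigr (fun=> 1%E)); last by move=> i _; rewrite ind1.
  by rewrite sumEFin big_const_nat subn0 iter_addr_0.
have [N FN minN] := ex_minnP (ex_intro (fun k => X k w \in F) k Fk).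
have before i : (i < N)%N -> X i w \notin F.
  by move=> iN; apply/negP => /minN; rewrite leqNgt iN.
rewrite (nneseries_split 0 N) => [|i _]; last exact: ge0.
rewrite add0n [X in (_ + X)%E]eseries0 ?adde0; last first.
  move=> i Ni _; rewrite indicE memNset //= => /hitting_time_gt_nat /(_ N Ni).
  by rewrite FN.
transitivity ((N%:R : R)%:E); last first.
  rewrite (eq_big_nat _ _ (F2 := fun=> 1%E)); last first.
    move=> i /andP[_ iN]; rewrite ind1 // => j ji.
    by apply: before; exact: leq_ltn_trans iN.
  by rewrite sumEFin big_const_nat subn0 iter_addr_0.
apply/eqP; rewrite eq_le; apply/andP; split.
  by apply: ereal_inf_lbound; exists N => //=; exact/set_mem.
apply: le_ereal_inf_tmp => _ [i /= /mem_set Fi <-].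
by rewrite lee_fin ler_nat minN.
Qed.

End HittingTime.

(** * The law of finite trajectories *)

Section PathLaw.
Variables (R : realType) (S : finType) (p : S -> S -> R) (x : S).
Variables (d : measure_display) (Omega : measurableType d).
Variables (P : probability Omega R) (X : nat -> Omega -> S).
Hypothesis X_chain : markov_chain p x P X.

Let mX t s : measurable [set w | X t w = s]. Proof. by case: X_chain. Qed.

Let prefix k (s : nat -> S) := [set w | forall i, (i <= k)%N -> X i w = s i].

Lemma measurable_prefix k s : measurable (prefix k s).
Proof.
rewrite (_ : prefix k s = \bigcap_(i in [set i | (i <= k)%N]) [set w | X i w = s i]).
  by apply: bigcap_measurableType => i _.
by apply/seteqP; split.
Qed.

Lemma path_event_split k t (B : seq S -> bool) :
  [set w | B [seq X i w | i <- iota k t.+2]] = \bigcup_(y in [set: S])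
    ([set w | X k w = y] `&` [set w | B (y :: [seq X i w | i <- iota k.+1 t.+1])]).
Proof.
apply/seteqP; split=> w /=; first by move=> Bw; exists (X k w).
by move=> [y _ [/= <-]].
Qed.

Lemma measurable_path_event k t (B : seq S -> bool) :
  measurable [set w | B [seq X i w | i <- iota k t.+1]].
Proof.
elim: t k B => [|t IH] k B.
  rewrite (_ : [set w | _] = \bigcup_(y in [set y | B [:: y]]) [set w | X k w = y]).
    by apply: fin_bigcup_measurable => //; exact: finite_finset.
  apply/seteqP; split=> w /=; first by move=> Bw; exists (X k w).
  by move=> [y /= By ->].
rewrite path_event_split; apply: fin_bigcup_measurable; first exact: finite_finset.
by move=> y _; apply: measurableI => //; exact: (IH k.+1 (fun s => B (y :: s))).
Qed.

(** The statement has to mention an arbitrary past, since the Markov property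
    is available only for full cylinders: the induction moves one position
    from the future to the past. *)
Lemma prefix_path_law t k s (B : seq S -> bool) :
  P (prefix k s `&` [set w | B [seq X i w | i <- iota k t.+1]]) =
  (P (prefix k s) * (path_prob p t (s k) B)%:E)%E.
Proof.
elim: t k s B => [|t IH] k s B.
  have -> : prefix k s `&` [set w | B [seq X i w | i <- iota k 1]] =
      if B [:: s k] then prefix k s else set0.
    apply/seteqP; split=> w /=; first by move=> [ws]; rewrite ws //; case: ifP.
    by case: ifPn => // Bs ws; split=> //; rewrite ws.
  by rewrite /=; case: (B _); rewrite ?mule1 // measure0 mule0.
pose ext y i := if (i <= k)%N then s i else y.
have prefixE y : prefix k.+1 (ext y) = prefix k s `&` [set w | X k.+1 w = y].
  apply/seteqP; split=> w /=.
    move=> ws; split=> [i ik|]; first by rewrite ws ?leqW // /ext ik.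
    by rewrite ws // /ext ltnn.
  move=> [ws wy] i; rewrite leq_eqVlt ltnS => /predU1P[->|ik].
    by rewrite /ext ltnn.
  by rewrite /ext ik ws.
pose E y := prefix k.+1 (ext y) `&`
  [set w | B (s k :: [seq X i w | i <- iota k.+1 t.+1])].
have -> : prefix k s `&` [set w | B [seq X i w | i <- iota k t.+2]] =
    \bigcup_(y in [set: S]) E y.
  apply/seteqP; split=> w /=.
    by move=> [ws Bw]; exists (X k.+1 w) => //; rewrite /E prefixE /= -(ws k).
  by move=> [y _]; rewrite /E prefixE /= => -[[ws _]]; rewrite -(ws k).
rewrite measure_fin_bigcup; first last.
- move=> y _; apply: measurableI; first exact: measurable_prefix.
  exact: (measurable_path_event k.+1 t (fun u => B (s k :: u))).
- move=> y z _ _ [w [[wy _] [wz _]]].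
  by have := wy k.+1 (leqnn _); rewrite wz // /ext ltnn.
- exact: finite_finset.
have -> : [set: S] = [set` index_enum S].
  by apply/seteqP; split=> y //= _; rewrite mem_index_enum.
rewrite -fsbig_seq ?index_enum_uniq //=.
under eq_bigr => y _.
  rewrite (IH k.+1 (ext y) (fun u => B (s k :: u))) /ext ltnn.
  over.
have Pext y : P (prefix k.+1 (ext y)) = (P (prefix k s) * (p (s k) y)%:E)%E.
  have [_ _ /(_ k (ext y))] := X_chain; rewrite /ext ltnn leqnn => Pk.
  rewrite /prefix Pk; congr (P _ * _)%E.
  by apply/seteqP; split=> w /= ws i ik; rewrite ws // ik.
have [a Pa] : exists a : R, P (prefix k s) = a%:E.
  by exists (fine (P (prefix k s))); rewrite fineK ?fin_num_measure //; exact: measurable_prefix.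
under eq_bigr do rewrite Pext Pa -!EFinM.
by rewrite sumEFin Pa -EFinM /= mulr_sumr; under eq_bigr do rewrite -mulrA.
Qed.

(** The chain starts at [x] almost surely, so the past of length one can be
    dropped. *)
Lemma path_law t (B : seq S -> bool) :
  P [set w | B [seq X i w | i <- iota 0 t.+1]] = (path_prob p t x B)%:E.
Proof.
have [_ X0 _] := X_chain.
have pre0 : prefix 0 (fun=> x) = [set w | X 0%N w = x].
  by apply/seteqP; split=> w /= => [->//|wx i]; rewrite leqn0 => /eqP ->.
have mB := measurable_path_event 0 t B.
have := prefix_path_law t 0 (fun=> x) B; rewrite pre0 X0 mul1e => <-.
rewrite (measureDI P mB (mX 0 x)) [X in (X + _)%E](_ : _ = 0%E).
  by rewrite add0e setIC.
apply/eqP; rewrite eq_le measure_ge0 andbT.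
apply: (le_trans (y := P (~` [set w | X 0%N w = x]))).
  by apply: le_measure; rewrite ?inE; [exact: measurableD|exact: measurableC|move=> w []].
by rewrite probability_setC // X0 subee.
Qed.

Implicit Types (F G : set S).

Lemma all_path F t w :
  all (fun y => y \notin F) [seq X i w | i <- iota 0 t.+1] <->
  (forall i, (i <= t)%N -> X i w \notin F).
Proof.
rewrite all_map; split=> [/allP h i it|h].
  by apply: h; rewrite mem_iota add0n ltnS it.
by apply/allP => i; rewrite mem_iota add0n ltnS => /h.
Qed.

Lemma hitting_tail_event F (t : R) : 0 <= t ->
  [set w | (t%:E < hitting_time R X F w)%E] =
  [set w | all (fun y => y \notin F) [seq X i w | i <- iota 0 (Num.truncn t).+1]].
Proof.
by move=> t0; apply/seteqP; split=> w /=;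
  [move/(hitting_time_gt _ _ _ t0)/all_path|move/all_path/hitting_time_gt; apply].
Qed.

Lemma hitting_tail_law F (t : R) : 0 <= t ->
  P [set w | (t%:E < hitting_time R X F w)%E] =
  (survival p F (Num.truncn t) x)%:E.
Proof. by move=> t0; rewrite hitting_tail_event // path_law. Qed.

Lemma measurable_hitting_tail F (t : R) : 0 <= t ->
  measurable [set w | (t%:E < hitting_time R X F w)%E].
Proof. by move=> t0; rewrite hitting_tail_event //; exact: measurable_path_event. Qed.

Lemma measurable_hitting_indicator F k :
  measurable_fun setT ((fun w =>
    (\1_[set w | ((k%:R : R)%:E < hitting_time R X F w)%E] w : R)%:E)
    : Omega -> \bar R).
Proof.
by apply/measurable_EFinP; apply: measurable_indic; exact: measurable_hitting_tail.
Qed.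

Lemma measurable_hitting_time F : measurable_fun setT (hitting_time R X F).
Proof.
have -> : hitting_time R X F = fun w => (\sum_(k <oo | k \in predT)
    (\1_[set w | ((k%:R : R)%:E < hitting_time R X F w)%E] w : R)%:E)%E.
  by apply/funext => w; exact: hitting_time_series.
apply: ge0_emeasurable_sum => [k w _ _|k _]; first by rewrite lee_fin indicE ler0n.
exact: measurable_hitting_indicator.
Qed.

Lemma expected_hitting_time F :
  (\int[P]_w hitting_time R X F w = \sum_(k <oo) (survival p F k x)%:E)%E.
Proof.
under eq_integral => w _ do rewrite hitting_time_series.
have mind := measurable_hitting_indicator F.
rewrite integral_nneseries //.
congr (limn _); apply/funext => n; apply: eq_bigr => k _.
have mtail := measurable_hitting_tail F (ler0n R k).
rewrite integral_indic // setIT.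
by have := hitting_tail_law F (ler0n R k); rewrite natrK.
Qed.

Lemma reaches_before_path a G t k j w : (j <= t)%N -> X (k + j)%N w = a ->
  (forall i, (i < j)%N -> X (k + i)%N w \notin G) ->
  reaches_before a G [seq X i w | i <- iota k t.+1].
Proof.
elim: t k j => [|t IH] k [|j] //= jt.
- by rewrite addn0 => ->; rewrite eqxx.
- by rewrite addn0 => ->; rewrite eqxx.
move=> Xa XG; have := XG 0%N isT; rewrite addn0 => -> /=.
apply/orP; right; apply: (IH k.+1 j) => // [|i ij]; first by rewrite addSnnS.
by rewrite addSnnS; exact: XG.
Qed.

(** If the two hitting times agree and the first is at most [t], then [a] is
    hit by time [t], before [G]. *)
Lemma basin_reach_lb a G (t : R) : 0 <= t ->
  (P [set w | hitting_time R X (a |` G) w = hitting_time R X [set a] w] <=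
   (reach p a G (Num.truncn t) x + survival p (a |` G) (Num.truncn t) x)%:E)%E.
Proof.
move=> t0; rewrite EFinD -hitting_tail_law // -path_law.
have mreach := measurable_path_event 0 (Num.truncn t) (reaches_before a G).
apply: le_trans (measureU2 _ mreach (measurable_hitting_tail _ t0)).
apply: le_measure; rewrite ?inE.
- rewrite -[X in measurable X]setTI.
  by apply: measurable_eqe => //; exact: measurable_hitting_time.
- by apply: measurableU => //; exact: measurable_hitting_tail.
move=> w /= tauE.
have [tF|] := pselect (t%:E < hitting_time R X (a |` G) w)%E; first by right.
rewrite hitting_time_gt // => /existsNP[k /not_implyP[kt /negP/negPn Fk]].
left; have [N FN minN] := ex_minnP (ex_intro (fun k => X k w \in a |` G) k Fk).
have before i : (i < N)%N -> X i w \notin a |` G.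
  by move=> iN; apply/negP => /minN; rewrite leqNgt iN.
have : ~ ((N%:R : R)%:E < hitting_time R X [set a] w)%E.
  by rewrite -tauE => /hitting_time_gt_nat /(_ N (leqnn N)); rewrite FN.
rewrite hitting_time_gt_nat => /existsNP[i /not_implyP[iN /negP/negPn/set_mem /= Xia]].
have {iN} iN : i = N.
  apply/eqP; rewrite eqn_leq iN leqNgt; apply/negP => /before.
  by rewrite mem_set //; left.
apply: (reaches_before_path (j := N)); first exact: leq_trans (minN _ Fk) kt.
  by rewrite add0n -iN.
move=> j /before; rewrite add0n; apply: contra => /set_mem Gj.
by rewrite mem_set //; right.
Qed.

(** Boundedness of the partial sums is what makes the expectation finite, and
    hence [fine] harmless. *)
Lemma mean_exit_time_lub F B :
  (forall N, \sum_(i < N) survival p F i x <= B) ->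
  (forall N, \sum_(i < N) survival p F i x <= mean_exit_time P X F) /\
  mean_exit_time P X F <= B.
Proof.
move=> SB; rewrite /mean_exit_time expected_hitting_time.
set E := (\sum_(k <oo) _)%E.
have ge0 k : (0%N <= k)%N -> true -> (0 <= (survival p F k x)%:E)%E.
  by move=> _ _; rewrite -[k](natrK (R := R)) -hitting_tail_law ?ler0n.
have SE N : ((\sum_(i < N) survival p F i x)%:E <= E)%E.
  by rewrite -sumEFin -(big_mkord xpredT (fun i => (survival p F i x)%:E))
    nneseries_lim_ge.
have EB : (E <= B%:E)%E.
  apply: lime_le; first exact: is_cvg_nneseries.
  by apply: nearW => N; rewrite sumEFin big_mkord lee_fin.
have Efin : E \is a fin_num.
  rewrite ge0_fin_numE; first exact: le_lt_trans EB (ltry _).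
  by have := SE 0%N; rewrite big_ord0.
by split=> [N|]; rewrite -lee_fin fineK.
Qed.

End PathLaw.

(** * Quantiles, means and basins of one chain *)

Section SingleChain.
Variables (R : realType) (S : finType) (p : S -> S -> R) (x : S).
Variables (d : measure_display) (Omega : measurableType d).
Variables (P : probability Omega R) (X : nat -> Omega -> S).
Hypothesis p_stoch : stochastic p.
Hypothesis X_chain : markov_chain p x P X.
Implicit Types (F G : set S).

(** The quantile is a natural number in all cases: if the level is never
    reached, the infimum is that of the empty set, which is 0 and not a
    genuine quantile.  This is why positivity of [q] carries the information. *)
Lemma exit_quantile_spec G (zeta : R) : exists q : nat,
  [/\ exit_quantile P X G zeta = q%:R,
      (0 < q)%N -> survival p G q x <= zeta,
      forall k, (0 < k < q)%N -> zeta < survival p G k x &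
      (exists k, survival p G k x <= zeta) -> (0 < q)%N].
Proof.
pose Q k := (0 < k)%N && (survival p G k x <= zeta).
have cdf k : P [set w | (hitting_time R X G w <= (k%:R : R)%:E)%E] =
    (1 - survival p G k x)%:E.
  rewrite (_ : [set w | _] = ~` [set w | ((k%:R : R)%:E < hitting_time R X G w)%E]).
    rewrite probability_setC; last exact: (measurable_hitting_tail X_chain).
    by rewrite (hitting_tail_law X_chain) // natrK.
  by apply/seteqP; split=> w /=; rewrite leNgt => /negP.
have -> : exit_quantile P X G zeta = inf [set k%:R | k in [set k : nat | Q k]].
  rewrite /exit_quantile; congr (inf [set k%:R | k in _]).
  apply/seteqP; split=> k; rewrite /Q /= cdf lee_fin lerD2l lerN2.
    by move=> [-> ->].
  by move/andP.
have [[k Qk]|noQ] := pselect (exists k, Q k); last first.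
  exists 0%N; split=> // [|k|[k fk]].
  - rewrite (_ : [set _ | _] = set0) ?image_set0 ?inf0 //.
    by apply/seteqP; split=> k //= Qk; apply: noQ; exists k.
  - by rewrite ltn0 andbF.
  - exfalso; apply: noQ; exists k.+1; rewrite /Q /=.
    by apply: le_trans fk; exact: survivalS_le.
have [q Qq minq] := ex_minnP (ex_intro Q k Qk).
have /andP[q0 fq] := Qq.
exists q; split=> // [|j /andP[j0 jq]].
  have lbq : lbound [set k%:R | k in [set k : nat | Q k]] (q%:R : R).
    by move=> _ [j /= Qj <-]; rewrite ler_nat minq.
  apply/eqP; rewrite eq_le; apply/andP; split.
    by apply: ge_inf; [exists q%:R|exists q].
  by apply: lb_le_inf => //; exists q%:R, q.
rewrite ltNge; apply/negP => fj.
by have := minq j; rewrite /Q j0 fj leqNgt jq => /(_ isT).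
Qed.

(** A positive value of [fine] can only come from a finite expectation. *)
Lemma mean_exit_time_sum_le G N : 0 < mean_exit_time P X G ->
  \sum_(i < N) survival p G i x <= mean_exit_time P X G.
Proof.
rewrite /mean_exit_time (expected_hitting_time X_chain).
set E := (\sum_(k <oo) _)%E => E0.
have Efin : E \is a fin_num by move: E0; case: E => // /=; rewrite ltxx.
rewrite -lee_fin fineK // -sumEFin.
rewrite -(big_mkord xpredT (fun i => (survival p G i x)%:E)).
by apply: nneseries_lim_ge => i _ _; rewrite lee_fin survival_ge0.
Qed.

Lemma small_survival G (zeta : R) : 0 < zeta -> 0 < mean_exit_time P X G ->
  exists k, survival p G k x <= zeta.
Proof.
move=> z0 T0; set T := mean_exit_time P X G.
pose N := (Num.truncn (T / zeta)).+1; exists N; rewrite leNgt; apply/negP => fN.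
have := mean_exit_time_sum_le N T0; rewrite leNgt => /negP; apply.
apply: (lt_le_trans (y := N%:R * zeta)).
  by rewrite -ltr_pdivrMr // truncnS_gt.
rewrite mulr_natl -[X in _ *+ X]card_ord -sumr_const.
apply: ler_sum => i _; apply: le_trans (ltW fN) _.
by apply: survival_le => //; exact: ltnW.
Qed.

Lemma hitting_time_start F w : X 0%N w \in F -> hitting_time R X F w = 0%E.
Proof.
move=> /set_mem F0; apply/eqP; rewrite eq_le; apply/andP; split.
  by apply: ereal_inf_lbound; exists 0%N.
by apply: le_ereal_inf_tmp => _ [i _ <-]; rewrite lee_fin ler0n.
Qed.

Lemma basin_start G :
  P [set w | hitting_time R X (x |` G) w = hitting_time R X [set x] w] = 1%E.
Proof.
have [mX X0 _] := X_chain.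
apply/eqP; rewrite eq_le probability_le1 /=; last first.
  rewrite -[X in measurable X]setTI.
  by apply: measurable_eqe => //; exact: (measurable_hitting_time X_chain).
rewrite -X0; apply: le_measure; rewrite ?inE //.
  rewrite -[X in measurable X]setTI.
  by apply: measurable_eqe => //; exact: (measurable_hitting_time X_chain).
move=> w /= Xw; rewrite !hitting_time_start //; apply/mem_set; rewrite Xw //.
by left.
Qed.

End SingleChain.

(** * Sequences of chains *)

Section ChainSequence.
Unset Implicit Arguments.
Variables (R : realType) (S : nat -> finType) (p : forall n, S n -> S n -> R).
Hypothesis p_stoch : forall n, stochastic (p n).
Variables (d : forall n, S n -> measure_display)
  (Omega : forall n (x : S n), measurableType (d n x))
  (P : forall n (x : S n), probability (Omega n x) R)
  (X : forall n (x : S n), nat -> Omega n x -> S n).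
Hypothesis X_chain : forall n (x : S n), markov_chain (p n) x (P n x) (X n x).
Variables (x0 : forall n, S n) (G : forall n, set (S n)).

Set Implicit Arguments.

Let f n t := survival (p n) (G n) t (x0 n).
Let TE n := mean_exit_time (P n (x0 n)) (X n (x0 n)) (G n).
Let Q zeta n := exit_quantile (P n (x0 n)) (X n (x0 n)) (G n) zeta.

Lemma HpG_renewal T : HpG P X x0 G T -> exists (m : nat -> nat) (r : nat -> R),
  [/\ forall n, renewal_bounds (f n) (m n) (r n),
      r n @[n --> \oo] --> (0 : R),
      (m n)%:R / T n @[n --> \oo] --> (0 : R) &
      forall n x, survival (p n) (x0 n |` G n) (m n) x <= r n].
Proof.
move=> [T0 _ [r [Rn [r0 r_0 Rn0 RnT sup_r]]]].
exists (fun n => Num.truncn (Rn n)), r.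
have tail n x : survival (p n) (x0 n |` G n) (Num.truncn (Rn n)) x <= r n.
  rewrite -lee_fin -(hitting_tail_law (X_chain n x)); last exact: ltW.
  by apply: le_trans (sup_r n); apply: ereal_sup_ubound; exists x.
split=> // [n|].
  split=> [|t|t|s t|s t|s t]; rewrite /f.
  - exact: ltW.
  - exact: survival_ge0.
  - exact: survival_le1.
  - exact: survival_le.
  - exact: survival_restart_ub.
  - exact: survival_restart_lb.
apply: (@squeeze_cvgr _ _ _ _ (fun=> 0) (fun n => Rn n / T n)) => //; last first.
  exact: cvg_cst.
apply: nearW => n; rewrite divr_ge0 ?ler0n ?(ltW (T0 n)) //=.
by rewrite ler_pM2r ?invr_gt0 // truncn_le ltW.
Qed.

Lemma quantile_asymptotics (lam : R) (m : nat -> nat) (r : nat -> R) :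
  0 < lam -> (forall n, renewal_bounds (f n) (m n) (r n)) ->
  r n @[n --> \oo] --> (0 : R) ->
  (m n)%:R / Q (expR (- lam)) n @[n --> \oo] --> (0 : R) ->
  Q (expR (- lam)) n @[n --> \oo] --> (+oo : set_system R) ->
  (forall (T : nat -> R) (h : R), 0 < h -> (forall n, 0 <= T n) ->
     T n / Q (expR (- lam)) n @[n --> \oo] --> h ->
     f n (Num.truncn (T n)) @[n --> \oo] --> expR (- (lam * h)) /\
     f n (Num.truncn (T n) - m n)%N @[n --> \oo] --> expR (- (lam * h)) /\
     \forall n \near \oo, (m n < Num.truncn (T n))%N) /\
  Q (expR (- lam)) n / TE n @[n --> \oo] --> lam.
Proof.
move=> lam0 rb r0 m0 Qoo; set z := expR (- lam) in m0 Qoo *.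
pose spec n := exit_quantile_spec (p_stoch n) (X_chain n (x0 n)) (G n) z.
have [q qP] := choice spec.
have QE : Q z = fun n => (q n)%:R by apply/funext => n; case: (qP n).
rewrite QE in m0 Qoo *.
have z1 : z < 1 by rewrite /z -[ltRHS]expR0 ltr_expR oppr_lt0.
have q_quantile : \forall n \near \oo, f n (q n) <= z < f n (q n).-1.
  move/cvgryPgt: Qoo => /(_ 1); apply: filterS => n; rewrite ltr1n => q1.
  case: (qP n) => _ fq qmin _; rewrite fq ?qmin //=; last exact: ltnW.
  by case: (q n) q1 => // k; rewrite ltnS => k0; rewrite /= k0 ltnSn.
split; last first.
  apply: (quantile_over_mean rb r0 m0 Qoo lam0 q_quantile) => n B SB.
  exact: mean_exit_time_lub.
move=> T h h0 T0 Th; have Ah := scale_truncn Qoo T0 Th.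
split; first exact: (survival_scale rb r0 m0 Qoo lam0 q_quantile h0 Ah).
split; last exact: (scale_lt Qoo m0 Ah h0).
apply: (survival_scale rb r0 m0 Qoo lam0 q_quantile h0).
by have := scaleB Qoo Ah m0 h0; rewrite subr0.
Qed.

(** [renewal_sum_ub] at the quantile bounds the mean by [(m + q) / (1 - r - zeta)],
    and [m] is negligible against the mean itself. *)
Lemma mean_controls_quantile (zeta : R) (m : nat -> nat) (r : nat -> R) :
  0 < zeta < 1 -> (forall n, renewal_bounds (f n) (m n) (r n)) ->
  r n @[n --> \oo] --> (0 : R) -> (forall n, 0 < TE n) ->
  (m n)%:R / TE n @[n --> \oo] --> (0 : R) ->
  \forall n \near \oo, TE n * ((1 - zeta) / 2) <= Q zeta n.
Proof.
move=> /andP[z0 z1] rb r0 TE0 m0.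
have c0 : 0 < (1 - zeta) / 4 by lra.
apply: filterS2 (cvg_lt_near r0 c0) (cvg_lt_near m0 c0) => n rn.
rewrite ltr_pdivrMr // => mn.
have [q [qE fq _ qex]] := exit_quantile_spec (p_stoch n) (X_chain n (x0 n)) (G n) zeta.
have {}fq : f n q <= zeta.
  by apply/fq/qex; apply: (small_survival (p_stoch n) (X_chain n (x0 n))) => //; exact: TE0.
rewrite /Q qE; have u1 : 0 < 1 - (r n + f n q) by lra.
have ub N : \sum_(i < N) f n i <= (m n + q)%:R / (1 - (r n + f n q)).
  by rewrite ler_pdivlMr //; exact: renewal_sum_ub.
have [_] := mean_exit_time_lub (X_chain n (x0 n)) ub.
rewrite -/(TE n) ler_pdivlMr // natrD.
have : TE n * f n q <= TE n * zeta by rewrite ler_pM2l.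
have : TE n * r n <= TE n * ((1 - zeta) / 4) by rewrite ler_pM2l // ltW.
by lra.
Qed.

Lemma mean_regime_quantile (zeta : R) (m : nat -> nat) (r : nat -> R) :
  0 < zeta < 1 -> (forall n, renewal_bounds (f n) (m n) (r n)) ->
  r n @[n --> \oo] --> (0 : R) -> (forall n, 0 < TE n) ->
  (m n)%:R / TE n @[n --> \oo] --> (0 : R) ->
  TE n @[n --> \oo] --> (+oo : set_system R) ->
  (m n)%:R / Q zeta n @[n --> \oo] --> (0 : R) /\
  Q zeta n @[n --> \oo] --> (+oo : set_system R).
Proof.
move=> z01 rb r0 TE0 m0 TEoo; have TQ := mean_controls_quantile z01 rb r0 TE0 m0.
have c0 : 0 < (1 - zeta) / 2 by case/andP: z01; lra.
split; last first.
  apply/cvgryPge => A; move/cvgryPge: TEoo => /(_ (A / ((1 - zeta) / 2))).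
  by move: TQ; apply: filterS2 => n TQn; rewrite ler_pdivrMr // => /le_trans; apply.
apply: (@squeeze_cvgr _ _ _ _ (fun=> 0)
  (fun n => (m n)%:R / TE n * ((1 - zeta) / 2)^-1)).
- apply: filterS TQ => n TQn.
  have TEc : 0 < TE n * ((1 - zeta) / 2) by rewrite mulr_gt0.
  have Q0 : 0 < Q zeta n by exact: lt_le_trans TQn.
  rewrite divr_ge0 ?ler0n ?(ltW Q0) //= -mulrA -invfM.
  by rewrite ler_wpM2l ?ler0n // lef_pV2.
- exact: cvg_cst.
- rewrite -[X in _ --> X](mul0r ((1 - zeta) / 2)^-1).
  by apply: cvgM => //; exact: cvg_cst.
Qed.

(** The bounds do not depend on the point of the basin, which gives the
    uniformity in the theorem. *)
Lemma basin_survival_bounds n (b r : R) (m A : nat) x :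
  (forall y, survival (p n) (x0 n |` G n) m y <= r) -> 0 < b -> (m <= A)%N ->
  basin P X x0 G b x ->
  f n A - (b + r) <= survival (p n) (G n) A x <= r + f n (A - m)%N.
Proof.
move=> Fr b0 mA; rewrite /basin /= => xB.
have reach_lb : 1 - b - r <= reach (p n) (x0 n) (G n) m x.
  have := basin_reach_lb (X_chain n x) (x0 n) (G n) (ler0n R m).
  rewrite natrK => /(lt_le_trans xB); rewrite lte_fin => h.
  by have := Fr x; lra.
apply/andP; split; last first.
  have := survival_pair_ub (p_stoch n) (x0 n) (G n) m (A - m) x.
  by rewrite subnKC // => /le_trans; apply; rewrite lerD2r.
apply: le_trans (survival_reach_lb (p_stoch n) (x0 n) (G n) m A x).
have f0 : 0 <= f n A by exact: survival_ge0.
have f1 : f n A <= 1 by exact: survival_le1.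
have r0 : 0 <= r by apply: le_trans (Fr x); exact: survival_ge0.
have h1 : (b + r) * f n A <= b + r by rewrite ler_piMr // addr_ge0 // ltW.
have h2 : (1 - b - r) * f n A <= reach (p n) (x0 n) (G n) m x * f n A.
  by rewrite ler_wpM2r.
by rewrite -/(f n A); lra.
Qed.

End ChainSequence.

Theorem theorem2p7 (R : realType) (S : nat -> finType)
    (p : forall n, S n -> S n -> R)
    (p_stoch : forall n, stochastic (p n))
    (p_irr : forall n, irreducible (p n))
    (d : forall n, S n -> measure_display)
    (Omega : forall n (x : S n), measurableType (d n x))
    (P : forall n (x : S n), probability (Omega n x) R)
    (X : forall n (x : S n), nat -> Omega n x -> S n)
    (X_chain : forall n (x : S n), markov_chain (p n) x (P n x) (X n x))
    (x0 : forall n, S n) (G : forall n, set (S n))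
    (G_neq0 : forall n, G n !=set0) :
  let tau n (x : S n) := hitting_time R (X n x) (G n) in
  let TE n := mean_exit_time (P n (x0 n)) (X n (x0 n)) (G n) in
  let Q zeta n := exit_quantile (P n (x0 n)) (X n (x0 n)) (G n) zeta in
  (HpG P X x0 G TE ->
     (forall t : R, 0 < t ->
        P n (x0 n) [set w | ((t * TE n)%:E < tau n (x0 n) w)%E]
          @[n --> \oo] --> (expR (- t))%:E) /\
     (forall r0 : nat -> R,
        (forall n, 0 < r0 n < 1) -> r0 n @[n --> \oo] --> (0 : R) ->
        forall t : R, 0 < t ->
        ereal_sup
          [set `|P n x [set w | ((t * TE n)%:E < tau n x w)%E]
                 - (expR (- t))%:E|%E
          | x in basin P X x0 G (r0 n)]
          @[n --> \oo] --> 0%E)) /\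
  (forall zeta : R, 0 < zeta < 1 ->
     HpG P X x0 G (Q zeta) ->
     (forall t : R, 0 < t ->
        P n (x0 n) [set w | ((t * Q zeta n)%:E < tau n (x0 n) w)%E]
          @[n --> \oo] --> (zeta `^ t)%:E) /\
     (Q zeta n / TE n) @[n --> \oo] --> - ln zeta).
Proof.
move=> tau TE Q; pose f n t := survival (p n) (G n) t (x0 n).
have tail_cvg (T : nat -> R) (l : R) : (forall n, 0 <= T n) ->
    f n (Num.truncn (T n)) @[n --> \oo] --> l ->
    P n (x0 n) [set w | ((T n)%:E < tau n (x0 n) w)%E] @[n --> \oo] --> l%:E.
  move=> T0 fl; under eq_fun do rewrite /tau (hitting_tail_law (X_chain _ _)) //.
  by apply: cvg_EFin => //; apply: nearW.
split=> [HpTE|zeta /andP[z0 z1] HpQ]; last first.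
  have [Q0 Qoo _] := HpQ.
  have [m [r [rb r0 m0 _]]] := HpG_renewal p_stoch X_chain HpQ.
  have zE : expR (- - ln zeta) = zeta by rewrite opprK lnK.
  have lam0 : 0 < - ln zeta by rewrite oppr_gt0 ln_lt0 // z0.
  have := quantile_asymptotics p_stoch X_chain lam0 rb r0.
  rewrite zE => /(_ m0 Qoo)[law ratio]; split=> // t t0.
  have TQ0 n : 0 <= t * Q zeta n by rewrite mulr_ge0 // ltW.
  apply: tail_cvg => //.
  have [] := law (fun n => t * Q zeta n) t t0 TQ0.
    apply: cvg_near_cst; apply: nearW => n.
    by rewrite mulfK // gt_eqF.
  by rewrite /powR gt_eqF // mulNr opprK mulrC.
have [TE0 TEoo _] := HpTE.
have [m [r [rb r_0 m0 Fr]]] := HpG_renewal p_stoch X_chain HpTE.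
have z01 : 0 < (expR (- 1) : R) < 1.
  by rewrite expR_gt0 -[ltRHS]expR0 ltr_expR oppr_lt0 ltr01.
(* The level exp(-1) has rate 1, so its quantile is equivalent to the mean. *)
have [mQ Qoo] := mean_regime_quantile p_stoch X_chain z01 rb r_0 TE0 m0 TEoo.
have [law ratio] := quantile_asymptotics p_stoch X_chain ltr01 rb r_0 mQ Qoo.
have TTE0 t n : 0 < t -> 0 <= t * TE n by move=> t0; rewrite mulr_ge0 // ltW.
have lawE t : 0 < t ->
    f n (Num.truncn (t * TE n)) @[n --> \oo] --> expR (- t) /\
    f n (Num.truncn (t * TE n) - m n)%N @[n --> \oo] --> expR (- t) /\
    \forall n \near \oo, (m n < Num.truncn (t * TE n))%N.
  move=> t0; have := law (fun n => t * TE n) t t0 (fun n => TTE0 t n t0).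
  rewrite mul1r; apply.
  have : t * (Q (expR (- 1)) n / TE n)^-1 @[n --> \oo] --> t * 1^-1.
    by apply: cvgM; [exact: cvg_cst|apply: cvgV => //; rewrite oner_neq0].
  by rewrite invr1 mulr1; apply: cvg_near_ext; apply: nearW => n; rewrite invf_div mulrA.
split=> [t t0|b b01 b0 t t0].
  by apply: tail_cvg => [n|]; [exact: TTE0|case: (lawE t t0)].
have [fA [fAm mA]] := lawE t t0.
pose A n := Num.truncn (t * TE n).
(* A bound uniform over the basin; the supremum is nonnegative because the
   reference point lies in its own basin. *)
pose delta n := `|f n (A n) - expR (- t)| + `|f n (A n - m n)%N - expR (- t)|
  + b n + r n.
have delta0 : delta n @[n --> \oo] --> (0 : R).
  have -> : 0 = 0 + 0 + 0 + 0 :> R by rewrite !addr0.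
  have norm0 (u : nat -> R) : u n @[n --> \oo] --> expR (- t) ->
      `|u n - expR (- t)| @[n --> \oo] --> (0 : R).
    move=> ul; rewrite -[X in _ --> X](normr0 R) -(subrr (expR (- t))).
    by apply: cvg_norm; apply: cvgB => //; exact: cvg_cst.
  by apply: cvgD => //; apply: cvgD => //; apply: cvgD; exact: norm0.
apply: (@squeeze_cvge _ _ _ _ (fun=> 0%E) _ (fun n => (delta n)%:E)).
- apply: filterS mA => n /ltnW mAn; apply/andP; split.
    apply: (le_trans (abse_ge0 _)); apply: ereal_sup_ubound.
    exists (x0 n) => //; rewrite /basin /= (basin_start (X_chain n (x0 n))) lte_fin.
    by case/andP: (b01 n); lra.
  apply: ge_ereal_sup => _ [x xB <-].
  rewrite /tau (hitting_tail_law (X_chain n x)) ?TTE0 // -EFinB lee_fin.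
  have /andP[bn0 _] := b01 n.
  have := basin_survival_bounds p_stoch X_chain (Fr n) bn0 mAn xB.
  rewrite -/(f n _) -/(f n _) -/(A n) => /andP[lo up].
  have h1 := ler_norm (f n (A n - m n)%N - expR (- t)).
  have := ler_norm (- (f n (A n) - expR (- t))); rewrite normrN => h2.
  have h3 := normr_ge0 (f n (A n) - expR (- t)).
  have h4 := normr_ge0 (f n (A n - m n)%N - expR (- t)).
  have h5 := rb_r (rb n).
  by rewrite /delta ler_norml; apply/andP; split; lra.
- exact: cvg_cst.
- by apply: cvg_EFin => //; apply: nearW.
Qed.
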